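(* Let $W$ be a nondeterministic recursive probabilistic program (given by its control-flow graph) with a sampling function $\Upsilon$. Suppose that (i) $(f,\ell)\in\Theta_{m^*}$ for all $f\in F$ and $\ell\in L^f$, and (ii) there exists a super-measure function $h$ for $W$. Then $\mathbb P^\sigma_{\mathfrak c}(T<\infty)=1$ and the function $k\mapsto\mathbb P^\sigma_{\mathfrak c}(T\ge k)$ is in $\mathcal O\!\left(\frac1{\sqrt k}\right)$ for all schedulers $\sigma$ and all non-terminal stack elements $\mathfrak c$ such that $h(\mathfrak c)\in(0,\infty)$.
   Context: **Programs.** For a finite set $V$ of variables, $\mathrm{Val}_V$ is the set of functions (valuations) $V\to\mathbb Z$. A nondeterministic recursive probabilistic program $W$ is represented by its control-flow graph: a finite set $F$ of function names, a finite set $V_r$ of sampling variables and, for each $f\in F$: a finite set $V^f$ of program variables (write $\mathrm{Val}_f:=\mathrm{Val}_{V^f}$); a finite set $L^f$ of labels partitioned into branching labels $L_b^f$, assignment labels $L_a^f$, call labels $L_c^f$ and nondeterministic labels $L_d^f$; an initial label $\ell_{in}^f\in L^f$ and a terminal label $\ell_{out}^f\in L^f$ with $\ell_{in}^f\ne\ell_{out}^f$; and a set $\to_f$ of triples (source label, decoration, target label). For each $\ell\in L^f\setminus\{\ell_{out}^f\}$ the triples with source $\ell$ are: - if $\ell\in L_a^f$: exactly one triple $(\ell,u,\ell')$ with update function $u:\mathrm{Val}_f\times\mathrm{Val}_{V_r}\to\mathrm{Val}_f$; - if $\ell\in L_c^f$: exactly one triple $(\ell,(g,v),\ell')$ with $g\in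 F$ and value-passing function $v:\mathrm{Val}_f\to\mathrm{Val}_g$; - if $\ell\in L_b^f$: exactly two triples $(\ell,\phi,\ell_1),(\ell,\neg\phi,\ell_2)$ with $\phi$ a propositional arithmetic predicate over $V^f$ (Boolean combination of comparisons of integer-valued arithmetic expressions); - if $\ell\in L_d^f$: exactly two triples $(\ell,\star,\ell_1),(\ell,\star,\ell_2)$ (the then-branch and the else-branch, respectively). **Sampling.** A sampling function $\Upsilon$ assigns to each $r\in V_r$ a discrete probability distribution on $\mathbb Z$; $\overline\Upsilon(\mu):=\prod_{r\in V_r}\Upsilon(r)(\mu(r))$ for $\mu\in\mathrm{Val}_{V_r}$, and $\mathrm{Val}^r:=\{\mu:\overline\Upsilon(\mu)>0\}$. **Semantics.** A stack element is a triple $(f,\ell,\nu)$ with $f\in F$, $\ell\in L^f$, $\nu\in\mathrm{Val}_f$; it is terminal if $\ell=\ell_{out}^f$. $\mathcal E$ is the set of stack elements. A configuration is a finite word (possibly the empty word $\varepsilon$) of non-terminal stack elements, the first letter being the top of the stack. For a stack element $\mathfrak d$ let $[\mathfrak d]$ be the one-letter word $\mathfrak d$ if $\mathfrak d$ is non-terminal and $\varepsilon$ otherwise. States are pairs $(w,\mu)$ of a configuration and $\mu\in\mathrm{Val}_{V_r}$. In one step from $((f,\ell,\nu)\cdot w,\mu)$, $\mu'$ is drawn with probability $\overline\Upsilon(\mu')$ and the next state is $(w',\mu')$ where - assignment: $w'=[(f,\ell',u(\nu,\mu'))]\cdot w$; - call: $w'=(g,\ell_{in}^g,v(\nu))\cdot[(f,\ell',\nu)]\cdot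 w$; - branching: $w'=[(f,\ell_1,\nu)]\cdot w$ if $\nu\models\phi$, and $w'=[(f,\ell_2,\nu)]\cdot w$ otherwise; - nondeterministic: $w'=[(f,\ell_1,\nu)]\cdot w$ under action $\mathbf{th}$ and $w'=[(f,\ell_2,\nu)]\cdot w$ under action $\mathbf{el}$. From $(\varepsilon,\mu)$ the next state is $(\varepsilon,\mu')$ with probability $\overline\Upsilon(\mu')$. In non-nondeterministic states there is effectively a single action $\tau$; when the top label is nondeterministic the enabled actions are $\mathbf{th},\mathbf{el}$. A history is a finite nonempty sequence of states in which each consecutive pair has positive transition probability under some action. A scheduler $\sigma$ maps every history to a probability distribution over the actions enabled at its last state. For a scheduler $\sigma$ and a non-terminal stack element $\mathfrak c$, $\mathbb P^\sigma_{\mathfrak c}$ is the induced probability measure on infinite sequences of states starting in $(\mathfrak c,\mathbf 0)$, where $\mathbf 0$ is the zero valuation. **Termination time.** $T(\{(w_n,\mu_n)\}_{n\ge0}):=\min\{n\ge 0: w_n=\varepsilon\}$ ($\min\emptyset=\infty$). **The set $\Theta_{m^*}$.** $\Theta_0:=\{(f,\ell): f\in F,\ \ell\in L_a^f\cup\{\ell_{out}^f\}\}$, and $\Theta_{n+1}$ is the union of $\Theta_n$ and of the following sets: all $(f,\ell)$ with $\ell\in L_c^f\setminus\{\ell_{out}^f\}$ such that $(f,\ell'),(g,\ell_{in}^g)\in\Theta_n$, where $(\ell,(g,v),\ell')$ is the only triple in $\to_f$ with source $\ell$; all $(f,\ell)$ with $\ell\in L_b^f\setminus\{\ell_{out}^f\}$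 such that $(f,\ell_1),(f,\ell_2)\in\Theta_n$, where $(\ell,\phi,\ell_1),(\ell,\neg\phi,\ell_2)$ are the two triples in $\to_f$ with source $\ell$; all $(f,\ell)$ with $\ell\in L_d^f\setminus\{\ell_{out}^f\}$ such that $(f,\ell_1),(f,\ell_2)\in\Theta_n$, where $(\ell,\star,\ell_1),(\ell,\star,\ell_2)$ are the two triples in $\to_f$ with source $\ell$. By finiteness the increasing sequence $\Theta_n$ stabilizes; $m^*$ is the smallest $m\in\mathbb N_0$ with $\Theta_n=\Theta_m$ for all $n\ge m$. **Super-measure functions.** A super-measure function for $W$ is a function $h:\mathcal E\to[0,\infty]$ for which there exist $\zeta,\delta\in(0,\infty)$ such that for all stack elements $(f,\ell,\nu)$: (D1) $\ell=\ell_{out}^f$ iff $h(f,\ell,\nu)=0$; and if $\ell\ne\ell_{out}^f$ and $h(f,\ell,\nu)<\infty$ then: - (D2) if $\ell\in L_a^f$ and $(\ell,u,\ell')$ is the only triple in $\to_f$ with source $\ell$, with $d(\mu):=h(f,\ell',u(\nu,\mu))-h(f,\ell,\nu)$: $\sum_{\mu\in\mathrm{Val}^r}\overline\Upsilon(\mu)h(f,\ell',u(\nu,\mu))\le h(f,\ell,\nu)$; $|d(\mu)|\le\zeta$ for all $\mu\in\mathrm{Val}^r$; and $\sum_{\mu\in\mathrm{Val}^r}\overline\Upsilon(\mu)|d(\mu)|\ge\delta$; - (D3) if $\ell\in L_c^f$ and $(\ell,(g,v),\ell')$ is the only triple in $\to_f$ with source $\ell$: $h(g,\ell_{in}^g,v(\nu))+h(f,\ell',\nu)\le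 h(f,\ell,\nu)$ and $|h(g,\ell_{in}^g,v(\nu))+h(f,\ell',\nu)-h(f,\ell,\nu)|\le\zeta$; - (D4) if $\ell\in L_b^f$ and $(\ell,\phi,\ell_1),(\ell,\neg\phi,\ell_2)$ are the two triples in $\to_f$ with source $\ell$: $\mathbf 1_{\nu\models\phi}h(f,\ell_1,\nu)+\mathbf 1_{\nu\models\neg\phi}h(f,\ell_2,\nu)\le h(f,\ell,\nu)$ and $|\mathbf 1_{\nu\models\phi}h(f,\ell_1,\nu)+\mathbf 1_{\nu\models\neg\phi}h(f,\ell_2,\nu)-h(f,\ell,\nu)|\le\zeta$; - (D5) if $\ell\in L_d^f$ and $(\ell,\star,\ell_1),(\ell,\star,\ell_2)$ are the two triples in $\to_f$ with source $\ell$: $\max\{h(f,\ell_1,\nu),h(f,\ell_2,\nu)\}\le h(f,\ell,\nu)$ and $\max_{i\in\{1,2\}}|h(f,\ell_i,\nu)-h(f,\ell,\nu)|\le\zeta$. Conventions: $d\cdot\infty=\infty$ for $d\in(0,\infty]$, $0\cdot\infty=0$. *)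

(* Defs.v *)
From HB Require Import structures.
From mathcomp Require Import all_boot all_order all_algebra.
From mathcomp Require Import all_classical all_reals all_analysis.

Set Implicit Arguments.
Unset Strict Implicit.
Unset Printing Implicit Defensive.

Import Order.TTheory GRing.Theory Num.Theory.
Import numFieldNormedType.Exports.

Local Open Scope classical_set_scope.
Local Open Scope ring_scope.

Definition valuation (V : finType) := {ffun V -> int}.

Variant cmp_op := CLt | CLe | CEq | CNe | CGe | CGt.

Definition holds_cmp (c : cmp_op) (m n : int) : bool :=
  match c with
  | CLt => m < n | CLe => m <= n | CEq => m == n
  | CNe => m != n | CGe => m >= n | CGt => m > n
  end.

(* Boolean combinations of comparisons of integer-valued expressions. No
   grammar of arithmetic expressions is fixed: an expression over V is given by
   the integer-valued function of the valuation that it denotes. *)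
Inductive predicate (V : finType) :=
| Cmp of cmp_op & (valuation V -> int) & (valuation V -> int)
| Neg of predicate V
| Conj of predicate V & predicate V
| Disj of predicate V & predicate V.

Fixpoint sat (V : finType) (nu : valuation V) (phi : predicate V) : bool :=
  match phi with
  | Cmp c e1 e2 => holds_cmp c (e1 nu) (e2 nu)
  | Neg p => ~~ sat nu p
  | Conj p q => sat nu p && sat nu q
  | Disj p q => sat nu p || sat nu q
  end.

(* All the control-flow triples leaving a label of the function f. The
   constructor tells whether the label is an assignment, call, branching or
   nondeterministic label. Both [Branch phi l1 l2] (triples (l, phi, l1) and
   (l, ~ phi, l2)) and [Nondet l1 l2] list the then-branch first. *)
Variant instr (F : finType) (V L : F -> finType) (Vr : finType) (f : F) :=
| Assign of (valuation (V f) -> valuation Vr -> valuation (V f)) & L f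
| Call (g : F) of (valuation (V f) -> valuation (V g)) & L f
| Branch of predicate (V f) & L f & L f
| Nondet of L f & L f.

Arguments Assign {F V L Vr f}.
Arguments Call {F V L Vr f}.
Arguments Branch {F V L Vr f}.
Arguments Nondet {F V L Vr f}.

(* [code] is total so that the terminal label also belongs to one of the four
   classes; the targets it gives for [lout f] are never used. *)
Record program := Program {
  fname : finType;
  svar : finType;
  pvar : fname -> finType;
  label : fname -> finType;
  lin : forall f, label f;
  lout : forall f, label f;
  lin_neq_lout : forall f, lin f != lout f;
  code : forall f, label f -> instr pvar label svar f
}.

Record pmf (R : realType) := Pmf {
  pmf_val :> int -> R;
  pmf_val_ge0 : forall z, 0 <= pmf_val z;
  pmf_val_sum1 : (\esum_(z in [set: int]) (pmf_val z)%:E = 1)%E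
}.

Definition sampling (R : realType) (W : program) := svar W -> pmf R.

Section Semantics.
Variables (R : realType) (W : program) (Upsilon : sampling R W).

Definition pval (f : fname W) := valuation (pvar f).
Definition rval := valuation (svar W).
HB.instance Definition _ (f : fname W) := Countable.on (pval f).
HB.instance Definition _ := Countable.on rval.

Definition Ubar (mu : rval) : R := \prod_(r : svar W) Upsilon r (mu r).
Definition Valr : set rval := [set mu | 0 < Ubar mu].

Definition lab_val (f : fname W) : Type := label f * pval f.
HB.instance Definition _ (f : fname W) := Countable.on (lab_val f).

Definition stack_elem : Type := {f : fname W & lab_val f}.
HB.instance Definition _ := Countable.on stack_elem.

Definition elem (f : fname W) (l : label f) (nu : pval f) : stack_elem :=
  existT _ f (l, nu).

Definition terminal (c : stack_elem) : bool := (tagged c).1 == lout (tag c).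

Definition nt_elem : Type := {c : stack_elem | ~~ terminal c}.
HB.instance Definition _ := SubType.copy nt_elem {c : stack_elem | ~~ terminal c}.
HB.instance Definition _ := Countable.on nt_elem.

Definition config : Type := seq nt_elem.
HB.instance Definition _ := Countable.on config.

Definition word_of (c : stack_elem) : config :=
  if insub c is Some e then [:: e] else [::].

Definition entry (f : fname W) (nu : pval f) : nt_elem :=
  exist (fun c => ~~ terminal c) (elem (lin f) nu) (lin_neq_lout f).

Definition state : Type := config * rval.
HB.instance Definition _ := Countable.on state.
HB.instance Definition _ := isPointed.Build state ([::], [ffun=> 0]).

Variant action := Tau | Th | El.
Definition action_code (a : action) : 'I_3 :=
  match a with Tau => inord 0 | Th => inord 1 | El => inord 2 end.
Definition action_decode (i : 'I_3) : action :=
  match val i with 0%N => Tau | 1%N => Th | _ => El end.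
Lemma action_codeK : cancel action_code action_decode.
Proof. by case; rewrite /action_decode /= inordK. Qed.
HB.instance Definition _ := Finite.copy action (can_type action_codeK).

Definition enabled (w : config) (a : action) : bool :=
  if w is c :: _ then
    match code (tagged (val c)).1 with
    | Nondet _ _ => a != Tau
    | _ => a == Tau
    end
  else a == Tau.

(* Meaningful for enabled a only. *)
Definition step (w : config) (a : action) (mu' : rval) : config :=
  if w is c :: w0 then
    let: existT f (l, nu) := val c in
    match code l with
    | Assign u l' => word_of (elem l' (u nu mu')) ++ w0
    | Call g v l' => entry (v nu) :: word_of (elem l' nu) ++ w0
    | Branch phi l1 l2 => word_of (elem (if sat nu phi then l1 else l2) nu) ++ w0
    | Nondet l1 l2 => word_of (elem (if a == El then l2 else l1) nu) ++ w0
    end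
  else [::].

Definition trans_prob (x : state) (a : action) (y : state) : R :=
  if enabled x.1 a && (y.1 == step x.1 a y.2) then Ubar y.2 else 0.

Definition pos_trans (x y : state) : bool := [exists a, 0 < trans_prob x a y].

Definition history (p : seq state) : bool :=
  if p is x :: q then path pos_trans x q else false.

Record scheduler := Scheduler {
  sched :> seq state -> action -> R;
  sched_ge0 : forall p a, history p -> 0 <= sched p a;
  sched_sum1 : forall p, history p -> \sum_(a : action) sched p a = 1;
  sched_enabled : forall x p a, history (x :: p) ->
    ~~ enabled (last x p).1 a -> sched (x :: p) a = 0
}.

Definition trajectory : Type := nat -> state.
HB.instance Definition _ := Pointed.on trajectory.

Definition cylinder (n : nat) (s : trajectory) : set trajectory :=
  [set t | forall i, (i <= n)%N -> t i = s i].

Definition cylinders : set (set trajectory) :=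
  [set A | exists n s, A = cylinder n s].

Definition traj_space := g_sigma_algebraType cylinders.

(* Probability, under sigma and from (c, 0), that the first n.+1 states are
   s 0, ..., s n. *)
Definition cyl_prob (sigma : scheduler) (c : nt_elem) (n : nat)
    (s : trajectory) : R :=
  (s 0%N == ([:: c], [ffun=> 0]))%:R *
  \prod_(i < n) \sum_(a : action)
     sigma (mkseq s i.+1) a * trans_prob (s i) a (s i.+1).

(* Characterizes the measure induced by sigma from c: cylinders form (with the
   empty set) an intersection-stable generator, so there is at most one such P,
   and one exists by the Ionescu-Tulcea theorem. *)
Definition induced_measure (sigma : scheduler) (c : nt_elem)
    (P : probability traj_space R) : Prop :=
  forall n s, P (cylinder n s) = (cyl_prob sigma c n s)%:E.

Definition stop_time (s : trajectory) : \bar R :=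
  match pselect (exists n, nilp (s n).1) with
  | left ex => ((ex_minn ex)%:R)%:E
  | right _ => +oo%E
  end.

Local Open Scope ereal_scope.

Definition super_measure_cond (h : stack_elem -> \bar R) (zeta delta : R)
    (f : fname W) (l : label f) (nu : pval f) : Prop :=
  let hl := h (elem l nu) in
  match code l with
  | Assign u l' =>
      let d := fun mu => h (elem l' (u nu mu)) - hl in
      [/\ \esum_(mu in Valr) ((Ubar mu)%:E * h (elem l' (u nu mu))) <= hl,
          forall mu, Valr mu -> `|d mu| <= zeta%:E
        & delta%:E <= \esum_(mu in Valr) ((Ubar mu)%:E * `|d mu|)]
  | Call g v l' =>
      let hs := h (elem (lin g) (v nu)) + h (elem l' nu) in
      hs <= hl /\ `|hs - hl| <= zeta%:E
  | Branch phi l1 l2 =>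
      let hs := (sat nu phi)%:R%:E * h (elem l1 nu) +
                (sat nu (Neg phi))%:R%:E * h (elem l2 nu) in
      hs <= hl /\ `|hs - hl| <= zeta%:E
  | Nondet l1 l2 =>
      Order.max (h (elem l1 nu)) (h (elem l2 nu)) <= hl /\
      Order.max `|h (elem l1 nu) - hl| `|h (elem l2 nu) - hl| <= zeta%:E
  end.

Definition super_measure (h : stack_elem -> \bar R) : Prop :=
  (forall c, 0 <= h c) /\
  exists zeta delta : R, [/\ (0 < zeta)%R, (0 < delta)%R &
    forall (f : fname W) (l : label f) (nu : pval f),
      (l = lout f <-> h (elem l nu) = 0) /\
      (l <> lout f -> h (elem l nu) < +oo ->
       super_measure_cond h zeta delta l nu)].

End Semantics.

Section Theta.
Variable W : program.

Let loc : finType := {f : fname W & label f}.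

Definition Theta0 : {set loc} :=
  [set x : loc | (tagged x == lout (tag x)) ||
     (if code (tagged x) is Assign _ _ then true else false)]%SET.

Definition ThetaS (A : {set loc}) : {set loc} :=
  (A :|: [set x : loc | (tagged x != lout (tag x)) &&
     let at_ l := existT _ (tag x) l \in A in
     match code (tagged x) with
     | Assign _ _ => false
     | Call g _ l' => at_ l' && (existT _ g (lin g) \in A)
     | Branch _ l1 l2 => at_ l1 && at_ l2
     | Nondet l1 l2 => at_ l1 && at_ l2
     end])%SET.

Fixpoint Theta (n : nat) : {set loc} :=
  if n is m.+1 then ThetaS (Theta m) else Theta0.

Lemma Theta_mono m n : (m <= n)%N -> Theta m \subset Theta n.
Proof.
move=> /subnK <-; elim: (n - m)%N => [|k IH] //.
by rewrite addSn /=; apply: (fintype.subset_trans IH); exact: finset.subsetUl.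
Qed.

Lemma Theta_stable :
  exists m, `[< forall n, (m <= n)%N -> Theta n = Theta m >].
Proof.
have ex : exists c, `[< exists m, #|Theta m| = c >].
  by exists #|Theta 0|; apply/asboolP; exists 0%N.
have ub c : `[< exists m, #|Theta m| = c >] -> (c <= #|loc|)%N.
  by move=> /asboolP[m <-]; exact: max_card.
case: (ex_maxnP ex ub) => c /asboolP[m cm] cmax.
exists m; apply/asboolP => n mn; apply/eqP; rewrite eq_sym.
by rewrite eqEcard Theta_mono//= cm cmax//; apply/asboolP; exists n.
Qed.

Definition mstar : nat := ex_minn Theta_stable.

End Theta.

(* Main.v *)
Require Import Defs.
From HB Require Import structures.
From mathcomp Require Import all_boot all_order all_algebra.
From mathcomp Require Import all_classical all_reals all_analysis.
From mathcomp Require Import ring lra.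

(* Let X_n be the sum of h over the stack, a nonnegative supermartingale that
   vanishes exactly at termination. Condition (i) provides weights on labels
   such that the total weight Phi_n of the stack drops by at least 1 at every
   step that is not an assignment, and grows by less than a constant D at an
   assignment. An assignment step satisfies E exp(- t (X_{n+1} - X_n)) >=
   1 + (t delta)^2 / 4 for t <= 1 / zeta, so for s of order t^2 / D the process
   exp(- t X_n - s Phi_n - s n) is a submartingale up to termination. Comparing
   its values at time 0 and at time k gives
     P (T > k) (1 - exp (- s k)) <= 1 - exp (- t X_0 - s Phi_0)
                                 <= t X_0 + s Phi_0,
   and t of order k^(-1/2) keeps s k bounded away from 0. *)

Set Implicit Arguments.
Unset Strict Implicit.
Unset Printing Implicit Defensive.

Import Order.TTheory GRing.Theory Num.Theory.
Import numFieldNormedType.Exports.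

Local Open Scope classical_set_scope.
Local Open Scope ring_scope.

(** * Countable sums, measures of fibers, and a quadratic lower bound for exp *)

(** Finite partial sums give one inequality for every nonnegative factor; the converse, for x > 0,
    is that same inequality applied to the factor 1/x and the family x a. *)
Lemma esumZl (R : realType) (T : choiceType) (D : set T) (x : R)
    (a : T -> \bar R) : 0 <= x -> (forall i, 0 <= a i)%E ->
  (\esum_(i in D) (x%:E * a i) = x%:E * \esum_(i in D) a i)%E.
Proof.
move=> x0 a0.
have le_esumZl (y : R) (b : T -> \bar R) : 0 <= y -> (forall i, 0 <= b i)%E ->
    (\esum_(i in D) (y%:E * b i) <= y%:E * \esum_(i in D) b i)%E.
  move=> y0 b0; apply: ge_ereal_sup => _ [X [finX XD] <-].
  by rewrite -ge0_mule_fsumr// lee_wpmul2l// ?lee_fin// esum_ge//; exists X.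
apply/eqP; rewrite eq_le le_esumZl//=.
have [->|xN0] := eqVneq x 0.
  by rewrite mul0e esum_ge0// => i _; rewrite mul0e.
have {x0 xN0}x0 : 0 < x by rewrite lt_def xN0.
rewrite -lee_pdivlMl//; apply: le_trans (le_esumZl _ _ _ _); last 2 first.
- by rewrite invr_ge0 ltW.
- by move=> i; rewrite mule_ge0 ?lee_fin ?a0// ltW.
by apply: le_esum => i Di; rewrite muleA -EFinM mulVf ?gt_eqF// mul1e.
Qed.

(** The fibers are numbered by [pickle], so sigma-additivity along [nat] applies; numbers that code
    no element of [S] carry the empty set and contribute 0. *)
Lemma measure_esum_fiber d (T : measurableType d) (R : realType)
    (mu : {measure set T -> \bar R}) (S : countType) (f : T -> S) (A : set T) :
  (forall y, measurable (A `&` f @^-1` [set y])) ->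
  mu A = (\esum_(y in [set: S]) mu (A `&` f @^-1` [set y]))%E.
Proof.
move=> mA.
pose B n := if @pickle_inv S n is Some y then A `&` f @^-1` [set y] else set0.
have BE y : B (pickle y) = A `&` f @^-1` [set y] by rewrite /B pickleK_inv.
have {1}-> : A = \bigcup_n B n.
  apply/seteqP; split => [t At|t [n _]].
    by exists (pickle (f t)) => //; rewrite BE.
  by rewrite /B; case: pickle_inv => // y [].
rewrite measure_bigcup//; last 2 first.
- by move=> n _; rewrite /B; case: pickle_inv.
- apply/trivIsetP => i j _ _ ij; rewrite -subset0 => t [].
  rewrite /B; have := @pickle_invK S i; have := @pickle_invK S j.
  case: pickle_inv => [y|//]; case: pickle_inv => [z|//] /= ej ei [_ /= fz] [_ /= fy].
  by move: ij; rewrite -ej -ei -fz fy eqxx.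
rewrite nneseries_esum// (esumID (range (@pickle S)))//.
rewrite [X in (_ + X)%E]esum1 ?adde0; last first.
  move=> n [_ /= nS]; rewrite /B; have := @pickle_invK S n.
  case: pickle_inv => [y /= yn|]; last by rewrite measure0.
  by exfalso; apply: nS; exists y.
rewrite (_ : _ `&` _ = range (@pickle S)); last first.
  by apply/seteqP; split=> [n []//|n Sn]; split => //=; rewrite in_setT.
rewrite esum_image; last by move=> x y _ _; exact: (pcan_inj pickleK).
by apply: eq_esum => y _; rewrite BE.
Qed.

(** The left side is (1 - y/2)^2 and exp(-y) = exp(-y/2)^2; squaring 1 - y/2 <= exp(-y/2) is
    legitimate because 1 - y/2 >= 0. *)
Lemma expRN_ge (R : realType) (y : R) : `|y| <= 1 ->
  1 - y + y ^+ 2 / 4 <= expR (- y).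
Proof.
move=> y1; have y2 : 0 <= 1 - y / 2 by move: y1; rewrite ler_norml => /andP[]; lra.
have -> : - y = - (y / 2) + - (y / 2) by field.
rewrite expRD -expr2; apply: le_trans (_ : (1 - y / 2) ^+ 2 <= _).
  by rewrite le_eqVlt; apply/orP; left; apply/eqP; field.
by rewrite lerXn2r ?nnegrE ?expR_ge0//; exact: expR_ge1Dx.
Qed.

(** * Weights on labels that decrease at every step other than an assignment *)

(* The two branches are added up instead of maximized: any bound on the number
   of assignment-free steps will do. *)
Fixpoint delay (W : program) (n : nat) (f : fname W) (l : label f) : nat :=
  if n is n'.+1 then
    if l == lout f then 0%N else
    match Defs.code l with
    | Assign _ _ => 0%N
    | Call g _ l' => (delay n' l' + delay n' (lin g)).+1
    | Branch _ l1 l2 | Nondet l1 l2 => (delay n' l1 + delay n' l2).+1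
    end
  else 0%N.

(** From a label of [Theta W n] the recursion reaches [Theta0], where it returns 0, within n
    unfoldings; fuel beyond n changes nothing. *)
Lemma delay_stable (W : program) (n k : nat) (f : fname W) (l : label f) :
  existT _ f l \in Theta W n -> (n <= k)%N -> delay k.+1 l = delay k l.
Proof.
have delay_Theta0 i g (l' : label g) :
    existT _ g l' \in Theta0 W -> delay i l' = 0%N.
  case: i => // i; rewrite inE /= => /orP[/eqP->|]; first by rewrite eqxx.
  by case: ifP => // _; case: Defs.code.
elim: n k f l => [|n IH] k f l; first by move=> l0 _; rewrite !delay_Theta0.
rewrite inE => /orP[ln nk|]; first exact: IH (ltnW nk).
case: k => [|k]; first by rewrite ltn0.
rewrite inE /= ltnS => /andP[/negbTE-> ln] nk.
by case: Defs.code ln => [//|g v l'|phi l1 l2|l1 l2] /andP[/IH + /IH];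
  move=> /(_ _ nk) + /(_ _ nk); rewrite /= => -> ->.
Qed.

(** A call replaces one stack entry by two, so the two weights must together stay below the old one.
    Weight 0 at the terminal label matches the fact that terminal elements are not stacked. *)
Definition assignment_delay (W : program) (m : forall f : fname W, label f -> nat) :=
  forall (f : fname W) (l : label f), m f (lout f) = 0%N /\
    (l != lout f ->
     match Defs.code l with
     | Assign _ _ => True
     | Call g _ l' => (m g (lin g) + m f l' < m f l)%N
     | Branch _ l1 l2 | Nondet l1 l2 => (m f l1 < m f l)%N /\ (m f l2 < m f l)%N
     end).

(** With fuel [mstar W] every label is stable, so [delay] can be unfolded once without lowering the
    fuel, and the successor in its defining equation gives the strict decrease. *)
Lemma exists_assignment_delay (W : program) :
  (forall (f : fname W) (l : label f), existT _ f l \in Theta W (mstar W)) ->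
  exists m, @assignment_delay W m.
Proof.
move=> full; exists (fun f l => delay (mstar W) l) => f l.
have stable g (l' : label g) := delay_stable (full g l') (leqnn _).
split=> [|/negbTE lN]; first by rewrite -stable /= eqxx.
rewrite -[delay _ l]stable /= lN.
set n := mstar W in stable *.
case: Defs.code => //= [g v l'|phi l1 l2|l1 l2]; first by rewrite addnC.
  by rewrite !ltnS leq_addr leq_addl.
by rewrite !ltnS leq_addr leq_addl.
Qed.

(** * Exponential gain of one assignment step *)

(* The sum is taken after adding [t g] on both sides, which keeps all terms
   nonnegative; [a ^+ 2 >= 2 delta a - delta ^+ 2] with [a = `|g - x|] replaces
   the Cauchy-Schwarz inequality. *)
Lemma esum_expRN_ge (R : realType) (T : choiceType) (p : T -> R)
    (g : T -> \bar R) (x t zeta delta : R) :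
  (forall i, 0 <= p i) -> (\esum_(i in [set: T]) (p i)%:E = 1)%E ->
  (forall i, 0 <= g i)%E -> 0 <= t -> t * zeta <= 1 -> 0 <= delta ->
  (forall i, (0 < p i)%R -> `|g i - x%:E| <= zeta%:E)%E ->
  (\esum_(i in [set i | (0 < p i)%R]) ((p i)%:E * g i) <= x%:E)%E ->
  (delta%:E <= \esum_(i in [set i | (0 < p i)%R]) ((p i)%:E * `|g i - x%:E|))%E ->
  ((1 + (t * delta) ^+ 2 / 4)%:E <=
    \esum_(i in [set: T]) (p i * expR (- (t * (fine (g i) - x))))%:E)%E.
Proof.
move=> p0 p1 g0 t0 tz d0 gx pg pd.
set D := [set i | 0 < p i] in pg pd *.
have restr (f : T -> R) : (\esum_(i in [set: T]) (p i * f i)%:E =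
    \esum_(i in D) (p i * f i)%:E)%E.
  rewrite [RHS]esum_mkcond; apply: eq_esum => i _; case: ifPn => //.
  rewrite notin_setE => /negP; rewrite -leNgt => pi.
  by rewrite (_ : p i = 0) ?mul0r//; apply/eqP; rewrite eq_le pi p0.
rewrite restr; set S := esum _ _.
have gE i : D i -> g i = (fine (g i))%:E.
  (* Where p is positive, g lies within zeta of the real x, hence is finite. *)
  move=> /gx; case: (g i) (g0 i) => [r||]//=.
have G0 i : 0 <= fine (g i) by rewrite fine_ge0.
have pD : (\esum_(i in D) (p i)%:E = 1)%E.
  rewrite -p1; have := restr (fun=> 1); under eq_esum do rewrite mulr1.
  by move=> ->; apply: eq_esum => i _; rewrite mulr1.
have pgE : (\esum_(i in D) ((p i)%:E * (fine (g i))%:E) <= x%:E)%E.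
  by apply: le_trans pg; apply: le_esum => i Di; rewrite -gE.
have pdE : (delta%:E <=
    \esum_(i in D) ((p i)%:E * `|fine (g i) - x|%:E))%E.
  by apply: le_trans pd _; apply: le_esum => i Di; rewrite {1}gE.
have key : (\esum_(i in D) ((1 + t * x)%:E * (p i)%:E +
      (t ^+ 2 * delta / 2)%:E * ((p i)%:E * `|fine (g i) - x|%:E)) <=
    \esum_(i in D) ((p i * expR (- (t * (fine (g i) - x))))%:E +
      (t%:E * ((p i)%:E * (fine (g i))%:E) +
      ((t * delta) ^+ 2 / 4)%:E * (p i)%:E)))%E.
  apply: le_esum => i Di; rewrite -!EFinM -!EFinD lee_fin.
  have : `|t * (fine (g i) - x)| <= 1.
    rewrite normrM ger0_norm// (le_trans _ tz)// ler_wpM2l//.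
    by have := gx i Di; rewrite {1}gE// lee_fin.
  move=> /expRN_ge; set y := fine (g i); set e := expR _ => ey.
  have y2 : (y - x) ^+ 2 = `|y - x| ^+ 2 by rewrite real_normK// num_real.
  have : 0 <= p i * (e - (1 - t * (y - x) + (t * (y - x)) ^+ 2 / 4)).
    by rewrite mulr_ge0// subr_ge0.
  have : 0 <= p i * (t ^+ 2 * (`|y - x| - delta) ^+ 2 / 4).
    by rewrite mulr_ge0// divr_ge0// mulr_ge0// sqr_ge0.
  rewrite [(t * (y - x)) ^+ 2]exprMn y2.
  nra.
have x0 : 0 <= x.
  by rewrite -lee_fin (le_trans _ pgE)// esum_ge0// => i _; rewrite mule_ge0 ?lee_fin.
have c1 : 0 <= 1 + t * x by rewrite addr_ge0// mulr_ge0.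
have c2 : 0 <= t ^+ 2 * delta / 2 by rewrite divr_ge0// mulr_ge0// sqr_ge0.
have c3 : 0 <= (t * delta) ^+ 2 / 4 by rewrite divr_ge0// sqr_ge0.
have nn (a b : R) : 0 <= a -> 0 <= b -> (0 <= a%:E * b%:E)%E.
  by move=> *; rewrite mule_ge0 ?lee_fin.
have a0 i : (0 <= (p i)%:E * `|fine (g i) - x|%:E)%E by exact: nn.
have b0 i : (0 <= (p i)%:E * (fine (g i))%:E)%E by exact: nn.
move: key.
rewrite esumD; [|by move=> i _; exact: nn|by move=> i _; rewrite mule_ge0].
rewrite esumD; last 2 first.
- by move=> i _; rewrite lee_fin mulr_ge0// expR_ge0.
- by move=> i _; rewrite adde_ge0 ?mule_ge0 ?lee_fin.
rewrite esumD; [|by move=> i _; rewrite mule_ge0|by move=> i _; exact: nn].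
rewrite !esumZl// pD !mule1 -/S.
have : ((t ^+ 2 * delta / 2)%:E * delta%:E <= (t ^+ 2 * delta / 2)%:E *
    \esum_(i in D) ((p i)%:E * `|fine (g i) - x|%:E))%E.
  by apply: lee_wpmul2l.
have : (t%:E * (\esum_(i in D) ((p i)%:E * (fine (g i))%:E)) <= t%:E * x%:E)%E.
  by apply: lee_wpmul2l.
move=> tB A key.
have {tB A key} : ((1 + t * x)%:E + (t ^+ 2 * delta / 2)%:E * delta%:E <=
    S + (t%:E * x%:E + ((t * delta) ^+ 2 / 4)%:E))%E.
  apply: le_trans (_ : _ <= _)%E (le_trans key _); [exact: leeD2l|].
  by apply: leeD2l; exact: leeD2r.
have : (0 <= S)%E by apply: esum_ge0 => i _; rewrite lee_fin mulr_ge0// expR_ge0.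
(* An infinite sum satisfies the bound trivially; otherwise only real linear arithmetic remains. *)
case: S => [r _|_ _|//]; last by rewrite leey.
rewrite -!EFinM -!EFinD !lee_fin; lra.
Qed.

(** * The exponential weight of a stack and its one-step drift *)

Section Potential.
Variables (R : realType) (W : program) (Upsilon : sampling R W).
Variables (h : stack_elem W -> \bar R) (m : forall f : fname W, label f -> nat).
Hypothesis h0 : forall c, (0 <= h c)%E.
Hypothesis h_lout : forall (f : fname W) (nu : pval f), h (elem (lout f) nu) = 0%E.
Hypothesis m_delay : assignment_delay m.

(** [height] and [load] are the processes X_n and Phi_n, as functions of the stack. *)
Definition height (w : config W) : \bar R := (\sum_(e <- w) h (val e))%E.

Definition load (w : config W) : nat :=
  (\sum_(e <- w) m (tagged (val e)).1)%N.

Lemma height_ge0 w : (0 <= height w)%E.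
Proof. exact: sume_ge0. Qed.

Lemma height_cons e w : height (e :: w) = (h (val e) + height w)%E.
Proof. exact: big_cons. Qed.

Lemma load_cons e w : load (e :: w) = (m (tagged (val e)).1 + load w)%N.
Proof. exact: big_cons. Qed.

Lemma height_word_of (f : fname W) (l : label f) (nu : pval f) w :
  height (word_of (elem l nu) ++ w) = (h (elem l nu) + height w)%E.
Proof.
rewrite /word_of; case: insubP => [e _ <-|]; first by rewrite height_cons.
by rewrite negbK /terminal /= => /eqP->; rewrite h_lout add0e.
Qed.

Lemma load_word_of (f : fname W) (l : label f) (nu : pval f) w :
  load (word_of (elem l nu) ++ w) = (m l + load w)%N.
Proof.
rewrite /word_of; case: insubP => [e _ ee|]; first by rewrite load_cons ee.
by rewrite negbK /terminal /= => /eqP->; rewrite (m_delay l).1.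
Qed.

Variables t s : R.

(* [height w = +oo] gets the weight [expR (- oo) = 0], for which the drift
   inequality is trivial. *)
Definition weight (w : config W) : R :=
  if height w == +oo%E then 0
  else expR (- (t * fine (height w) + s * (load w)%:R)).

Lemma weight_ge0 w : 0 <= weight w.
Proof. by rewrite /weight; case: ifP => // _; exact: expR_ge0. Qed.

Hypotheses (t0 : 0 <= t) (s0 : 0 <= s).

Lemma weight_le1 w : weight w <= 1.
Proof.
rewrite /weight; case: ifP => // _.
by rewrite expR_le1 oppr_le0 addr_ge0// mulr_ge0// fine_ge0 ?height_ge0.
Qed.

Lemma le_weight (w w' : config W) : (height w' <= height w)%E ->
  (load w' < load w)%N -> expR s * weight w <= weight w'.
Proof.
move=> hw lw; rewrite /weight.
have [hoo|hNoo] := eqVneq (height w) +oo%E.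
  by rewrite mulr0; case: ifP => // _; exact: expR_ge0.
have hlt : (height w < +oo)%E by rewrite ltey.
have -> : (height w' == +oo%E) = false by rewrite lt_eqF// (le_lt_trans hw).
rewrite -expRD ler_expR.
have : t * fine (height w') <= t * fine (height w).
  by rewrite ler_wpM2l// fine_le// ge0_fin_numE ?height_ge0// (le_lt_trans hw).
have : s * (load w').+1%:R <= s * (load w)%:R by rewrite ler_wpM2l// ler_nat.
rewrite -natr1 mulrDr mulr1; lra.
Qed.

Variables zeta delta : R.
Hypotheses (tz : t * zeta <= 1) (delta0 : 0 <= delta).
Hypothesis h_cond : forall (f : fname W) (l : label f) (nu : pval f),
  l <> lout f -> (h (elem l nu) < +oo)%E -> super_measure_cond Upsilon h zeta delta l nu.
Variable D : nat.
Hypothesis m_lt : forall (f : fname W) (l : label f), (m l < D)%N.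
Hypothesis sD : expR (s * D%:R) <= 1 + (t * delta) ^+ 2 / 4.
Hypothesis Ubar_sum1 : (\esum_(mu in [set: rval W]) (Ubar Upsilon mu)%:E = 1)%E.

Lemma Ubar_ge0 mu : 0 <= Ubar Upsilon mu.
Proof. by apply: prodr_ge0 => r _; exact: pmf_val_ge0. Qed.

(** At a step that is not an assignment the drop of [load] pays for the factor exp(s). At an
    assignment the gain 1 + (t delta)^2 / 4 pays for it together with the growth of [load]. The
    bound is uniform in the action, so it survives averaging by any scheduler. *)
Lemma weight_drift (e : nt_elem W) (w : config W) (a : action) :
  ((expR s * weight (e :: w))%:E <= \esum_(mu in [set: rval W])
     (Ubar Upsilon mu * weight (step (e :: w) a mu))%:E)%E.
Proof.
(* When the next stack does not depend on the sample, the sum is its weight times the total mass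
   1. *)
have det (w' : config W) : (height w' <= height (e :: w))%E ->
    (load w' < load (e :: w))%N ->
    ((expR s * weight (e :: w))%:E <= \esum_(mu in [set: rval W])
      (Ubar Upsilon mu * weight w')%:E)%E.
  move=> hw lw; under eq_esum do rewrite mulrC EFinM.
  rewrite esumZl ?weight_ge0 ?Ubar_sum1 ?mule1 ?lee_fin ?le_weight//.
  by move=> mu; rewrite lee_fin Ubar_ge0.
have [hoo|hNoo] := eqVneq (height (e :: w)) +oo%E.
  rewrite /weight hoo eqxx mulr0 esum_ge0// => mu _.
  by rewrite lee_fin mulr_ge0 ?weight_ge0 ?Ubar_ge0.
move: hNoo; rewrite -ltey height_cons => hlt.
have [he hw] : (h (val e) < +oo)%E /\ (height w < +oo)%E.
  by split; apply: le_lt_trans hlt; rewrite ?leeDl ?leeDr ?height_ge0.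
move: det; rewrite !load_cons !height_cons /step.
case: e he hlt => -[f [l nu]] lN /= he hlt.
have lN' : l != lout f by exact: lN.
have := (m_delay l).2 lN'; have := h_cond (elimN eqP lN') he.
rewrite /super_measure_cond.
case: Defs.code => [u l'|g v l'|phi l1 l2|l1 l2].
- move=> [hle hz hd] _ _.
  set c := elem l nu in he hlt hle hz hd *.
  have hcE : h c = (fine (h c))%:E by rewrite fineK// ge0_fin_numE.
  have hwE : height w = (fine (height w))%:E.
    by rewrite fineK// ge0_fin_numE ?height_ge0.
  rewrite hcE in hle hz hd.
  have := esum_expRN_ge Ubar_ge0 Ubar_sum1 (fun mu => h0 (elem l' (u nu mu)))
    t0 tz delta0 hz hle hd.
  set K := expR s * weight _ => drift.
  have K0 : 0 <= K by rewrite mulr_ge0 ?expR_ge0 ?weight_ge0.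
  have e0 : 0 < expR (- (s * D%:R)) by exact: expR_gt0.
  (* By [sD], K = K exp(-s D) exp(s D) is at most K exp(-s D) times the gain. *)
  apply: (@le_trans _ _ ((K * expR (- (s * D%:R)))%:E *
      (1 + (t * delta) ^+ 2 / 4)%:E)%E).
    rewrite -EFinM lee_fin -mulrA ler_peMr// -[leLHS](expRxMexpNx_1 (s * D%:R)).
    by rewrite mulrC ler_wpM2l// ltW.
  apply: le_trans (lee_wpmul2l _ drift) _; first by rewrite lee_fin mulr_ge0// ltW.
  rewrite -esumZl; last 2 first.
  - by rewrite mulr_ge0// ltW.
  - by move=> mu; rewrite lee_fin mulr_ge0 ?Ubar_ge0 ?expR_ge0.
  apply: le_esum => mu _; rewrite -EFinM lee_fin.
  (* Finiteness of the next height is known only for samples of positive probability; for the others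
     both sides vanish. *)
  have [->|UN0] := eqVneq (Ubar Upsilon mu) 0; first by rewrite !mul0r mulr0.
  have Umu : Valr Upsilon mu by rewrite /Valr /= lt_def UN0 Ubar_ge0.
  rewrite mulrCA ler_wpM2l ?Ubar_ge0//.
  have hE : h (elem l' (u nu mu)) = (fine (h (elem l' (u nu mu))))%:E.
    by have := hz _ Umu; case: (h (elem l' _)) (h0 (elem l' (u nu mu))).
  rewrite /K /weight height_cons height_word_of hcE hwE hE -!EFinD /=.
  rewrite -!expRD ler_expR load_word_of load_cons /=.
  (* Since m l' + 1 <= D, the factor exp(-s D) absorbs both exp(s) and the new load. *)
  have ml : s * (m l').+1%:R <= s * D%:R by rewrite ler_wpM2l// ler_nat.
  have ml0 : 0 <= s * (m l)%:R by rewrite mulr_ge0.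
  move: ml; rewrite !natrD -natr1; lra.
- move=> [hle _] ml det; apply: det.
    rewrite height_cons height_word_of addeA leeD2r//.
  by rewrite load_cons load_word_of /= addnA ltn_add2r.
- move=> [hle _] [ml1 ml2] det; apply: det.
    rewrite height_word_of leeD2r// (le_trans _ hle)//=.
    by case: sat; rewrite /= ?mul1e ?mul0e ?adde0 ?add0e.
  by rewrite load_word_of ltn_add2r; case: sat.
- move=> [hle _] [ml1 ml2] det; apply: det.
    rewrite height_word_of leeD2r// (le_trans _ hle)//=.
    by case: ifP; rewrite le_max lexx ?orbT.
  by rewrite load_word_of ltn_add2r; case: ifP.
Qed.
End Potential.

(** * Cylinder probabilities and survival of the process *)

Section Trajectories.
Variables (R : realType) (W : program) (Upsilon : sampling R W).
Variables (sigma : scheduler Upsilon) (c : nt_elem W).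
Variables (P : probability (traj_space W) R) (P_induced : induced_measure sigma c P).

(** There are countably many finite state sequences, so an event decided by a prefix is a countable
    union of cylinders. *)
Lemma measurable_prefix (Q : pred (seq (state W))) (n : nat) :
  measurable ([set t | Q (mkseq t n.+1)] : set (traj_space W)).
Proof.
pose B p : set (traj_space W) :=
  if Q p && (size p == n.+1) then cylinder n (nth ([::], [ffun=> 0]) p) else set0.
rewrite (_ : [set _ | _] = \bigcup_p B p).
  apply: countable_bigcupT_measurable; first exact: countableP.
  move=> p; rewrite /B; case: ifP => _ //; apply: sub_sigma_algebra.
  by exists n, (nth ([::], [ffun=> 0]) p).
apply/seteqP; split=> [t /= Qt|t [p _]].
  exists (mkseq t n.+1) => //; rewrite /B Qt size_mkseq eqxx => i ni.
  by rewrite nth_mkseq.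
rewrite /B; case: ifP => // /andP[Qp /eqP sp] tp /=.
rewrite (_ : mkseq t n.+1 = p)//; apply: (@eq_from_nth _ ([::], [ffun=> 0])).
  by rewrite size_mkseq.
by move=> i; rewrite size_mkseq => ni; rewrite nth_mkseq// tp.
Qed.

Lemma measurable_cylinder n (s : trajectory W) :
  measurable (cylinder n s : set (traj_space W)).
Proof. by apply: sub_sigma_algebra; exists n, s. Qed.

Lemma measure_next_state n (A : set (traj_space W)) : measurable A ->
  (P A = \esum_(y in [set: state W]) P (A `&` [set t | t n.+1 = y]))%E.
Proof.
move=> mA; apply: (measure_esum_fiber P (f := fun t : traj_space W => t n.+1)) => y.
apply: measurableI => //.
rewrite (_ : _ @^-1` _ = [set t | nth y (mkseq t n.+2) n.+1 == y]).
  exact: (measurable_prefix (fun p => nth y p n.+1 == y)).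
have E (t : trajectory W) : nth y (mkseq t n.+2) n.+1 = t n.+1 by rewrite nth_mkseq.
apply/seteqP; split=> t ht.
  suff : nth y (mkseq t n.+2) n.+1 == y by [].
  by rewrite E; apply/eqP.
have /eqP : nth y (mkseq t n.+2) n.+1 == y by [].
by rewrite E.
Qed.

Definition alive (n : nat) : set (traj_space W) :=
  [set t | forall i, (i <= n)%N -> ~~ nilp (t i).1].

Lemma measurable_alive n : measurable (alive n).
Proof.
rewrite (_ : alive n =
    [set t | all (fun x => ~~ nilp x.1) (mkseq t n.+1)]).
  exact: (measurable_prefix (all (fun x => ~~ nilp x.1))).
apply/seteqP; split=> t ht.
  suff : all (fun x : state W => ~~ nilp x.1) (mkseq t n.+1) by [].
  by apply/allP => _ /mapP[i + ->]; rewrite mem_iota => /andP[_ /ht].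
have /allP{}ht : all (fun x : state W => ~~ nilp x.1) (mkseq t n.+1) by [].
by move=> i ni; apply: ht; apply/mapP; exists i; rewrite // mem_iota.
Qed.

Definition extend (s : trajectory W) (n : nat) (y : state W) : trajectory W :=
  fun i => if i == n.+1 then y else s i.

Lemma cylinder_extend n (s : trajectory W) y :
  cylinder n s `&` [set t | t n.+1 = y] = cylinder n.+1 (extend s n y).
Proof.
apply/seteqP; split => [t [ts ty] i|t ts].
  rewrite /extend; case: eqP => [->//|/eqP iN]; rewrite leq_eqVlt (negbTE iN).
  exact: ts.
split; last by rewrite /= (ts n.+1) /extend ?eqxx.
by move=> i ni; rewrite (ts i (leqW ni)) /extend ltn_eqF.
Qed.

(** The current state [x] is passed separately from the history [p]; in use it is the last entry of
    [p]. *)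
Definition kernel (p : seq (state W)) (x y : state W) : R :=
  \sum_(a : action) sigma p a * trans_prob Upsilon x a y.

Lemma trans_prob_ge0 x a y : 0 <= trans_prob Upsilon x a y.
Proof. by rewrite /trans_prob; case: ifP => // _; exact: Ubar_ge0. Qed.

Lemma cylinder_extendE n (s : trajectory W) y :
  P (cylinder n.+1 (extend s n y)) =
    (P (cylinder n s) * (kernel (mkseq s n.+1) (s n) y)%:E)%E.
Proof.
rewrite !P_induced -EFinM /cyl_prob -mulrA big_ord_recr /=.
have ext i : (i <= n)%N -> extend s n y i = s i.
  by move=> ni; rewrite /extend ltn_eqF.
have extS i : (i <= n)%N -> mkseq (extend s n y) i.+1 = mkseq s i.+1.
  move=> ni; apply/eq_in_map => j; rewrite mem_iota ltnS => /andP[_ ji].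
  by rewrite ext// (leq_trans ji).
rewrite ext//; congr (_ * (_ * _))%:E.
  by apply: eq_bigr => i _; rewrite extS ?ext// ltnW.
by rewrite /kernel extS// ext// /extend eqxx.
Qed.

Lemma last_mkseq (s : trajectory W) n : last (s 0%N) (mkseq s n.+1) = s n.
Proof. by rewrite mkseqS last_rcons. Qed.

(** The axioms of a scheduler speak only about histories; this makes them available on every
    cylinder of nonzero measure. *)
Lemma cylinder_history n (s : trajectory W) :
  P (cylinder n s) != 0%E -> history Upsilon (mkseq s n.+1).
Proof.
elim: n => [|n IH] //.
have -> : cylinder n.+1 s = cylinder n.+1 (extend s n (s n.+1)).
  by congr cylinder; apply/funext => i; rewrite /extend; case: eqP => [->|].
rewrite cylinder_extendE mule_eq0 negb_or => /andP[/IH hist ker].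
have -> : mkseq s n.+2 = rcons (mkseq s n.+1) (s n.+1).
  exact: mkseqS.
move: hist; rewrite /= rcons_path => -> /=.
have -> : last (s 0%N) [seq s i | i <- iota 1 n] = s n.
  exact: (last_mkseq s n).
apply: contraR ker; rewrite negb_exists => /forallP tr0.
rewrite eqe /kernel big1// => a _.
suff -> : trans_prob Upsilon (s n) a (s n.+1) = 0 by rewrite mulr0.
by apply/eqP; have := tr0 a; rewrite lt_def trans_prob_ge0 andbT negbK.
Qed.

(** Only states of the form ([step x.1 a mu], [mu]) have positive probability, and [mu] parametrizes
    them injectively. *)
Lemma esum_trans_prob x a (G : state W -> R) : (forall y, 0 <= G y) ->
  (\esum_(y in [set: state W]) (trans_prob Upsilon x a y * G y)%:E =
   if enabled x.1 a then
     \esum_(mu in [set: rval W]) (Ubar Upsilon mu * G (step x.1 a mu, mu))%:E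
   else 0)%E.
Proof.
move=> G0; rewrite /trans_prob; case: ifP => xa; last first.
  by apply: esum1 => y _; rewrite mul0r.
rewrite (esumID (range (fun mu => (step x.1 a mu, mu))))//; last first.
  by move=> y _; rewrite lee_fin mulr_ge0//; case: ifP => // _; exact: Ubar_ge0.
rewrite [X in (_ + X)%E]esum1 ?adde0; last first.
  move=> [w mu] [_ yN] /=; case: eqP => [wE|]; last by rewrite mul0r.
  by exfalso; apply: yN; exists mu; rewrite // wE.
rewrite setTI esum_image; last by move=> mu nu _ _ [].
by apply: eq_esum => mu _ /=; rewrite eqxx.
Qed.

(** Actions that are not enabled have scheduler weight 0, which removes the case distinction of
    [esum_trans_prob]. *)
Lemma esum_kernel n (s : trajectory W) (G : state W -> R) :
  history Upsilon (mkseq s n.+1) -> (forall y, 0 <= G y) ->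
  (\esum_(y in [set: state W]) (kernel (mkseq s n.+1) (s n) y * G y)%:E =
   \sum_(a : action) (sigma (mkseq s n.+1) a)%:E *
     \esum_(mu in [set: rval W]) (Ubar Upsilon mu * G (step (s n).1 a mu, mu))%:E)%E.
Proof.
move=> hist G0.
transitivity (\esum_(y in [set: state W]) \sum_(a : action)
    (sigma (mkseq s n.+1) a)%:E * (trans_prob Upsilon (s n) a y * G y)%:E)%E.
  apply: eq_esum => y _; rewrite /kernel mulr_suml -sumEFin.
  by apply: eq_bigr => a _; rewrite -mulrA EFinM.
rewrite esum_sum; last first.
  move=> y a _ _; rewrite -EFinM lee_fin mulr_ge0 ?sched_ge0//.
  by rewrite mulr_ge0 ?trans_prob_ge0.
apply: eq_bigr => a _; rewrite esumZl ?sched_ge0 ?esum_trans_prob//.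
  case: ifPn => // na; suff -> : sigma (mkseq s n.+1) a = 0 by rewrite !mul0e.
  apply: (@sched_enabled _ _ _ sigma (s 0%N) [seq s i | i <- iota 1 n] a hist).
  by rewrite [last _ _](last_mkseq s n).
by move=> y; rewrite lee_fin mulr_ge0 ?trans_prob_ge0.
Qed.

(* The total mass of the sampling product is read off the one-step marginal of
   [P], which avoids computing the sum of a product distribution. *)
Lemma Ubar_sum1 : (\esum_(mu in [set: rval W]) (Ubar Upsilon mu)%:E = 1)%E.
Proof.
pose s : trajectory W := fun=> ([:: c], [ffun=> 0]).
have P0 : P (cylinder 0 s) = 1%E.
  by rewrite P_induced /cyl_prob big_ord0 eqxx mul1r.
have hist : history Upsilon (mkseq s 1) by [].
have := P0; rewrite (measure_next_state 0 (measurable_cylinder _ _)).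
under eq_esum => y _.
  rewrite cylinder_extend cylinder_extendE P0 mul1e -[kernel _ _ _]mulr1.
  over.
rewrite (esum_kernel hist)// => <-.
under [RHS]eq_bigr => a _ do under eq_esum => mu _ do rewrite mulr1.
by rewrite -ge0_sume_distrl ?sumEFin ?sched_sum1 ?mul1e// => a _; rewrite lee_fin sched_ge0.
Qed.

(* With [b] and [m] the two probabilities, the induction step follows from
   [(1 - expR (- r * k)) b + expR r * F m <= m], obtained by summing the
   induction hypothesis over the next state, and from [b <= m]. *)
Lemma survival_bound (F : config W -> R) (r : R) :
  (forall w, 0 <= F w <= 1) -> 0 <= r ->
  (forall e w a, (expR r * F (e :: w))%:E <= \esum_(mu in [set: rval W])
     (Ubar Upsilon mu * F (step (e :: w) a mu))%:E)%E ->
  forall k n s, (P (cylinder n s `&` alive (n + k)) * (1 - expR (- (r * k%:R)))%:E <=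
    P (cylinder n s) * (1 - F (s n).1)%:E)%E.
Proof.
move=> F01 r0 drift; elim=> [|k IH] n s.
  rewrite mulr0 oppr0 expR0 subrr mule0 mule_ge0// lee_fin subr_ge0.
  by case/andP: (F01 (s n).1).
have [m0|mN0] := eqVneq (P (cylinder n s)) 0%E.
  have mA : P (cylinder n s `&` alive (n + k.+1)) = 0%E.
    apply/eqP; rewrite eq_le measure_ge0 andbT -m0 le_measure ?inE//.
    - by apply: measurableI; [exact: measurable_cylinder|exact: measurable_alive].
    - exact: measurable_cylinder.
  by rewrite m0 mA !mul0e.
have hist := cylinder_history mN0.
case sw : (s n).1 => [|e w].
  (* An empty stack at time n excludes survival, so the left side is 0. *)
  rewrite (_ : _ `&` _ = set0).
    rewrite measure0 mul0e mule_ge0// lee_fin subr_ge0.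
    by case/andP: (F01 [::]).
  rewrite -subset0 => t [/(_ n (leqnn _)) tn /(_ n (leq_addr _ _))].
  by rewrite tn sw.
have q0 y : 0 <= kernel (mkseq s n.+1) (s n) y.
  by apply: sumr_ge0 => a _; rewrite mulr_ge0 ?sched_ge0 ?trans_prob_ge0.
have F0 w' : 0 <= F w' by case/andP: (F01 w').
have F1 w' : 0 <= 1 - F w' by rewrite subr_ge0; case/andP: (F01 w').
have mI : measurable (cylinder n s `&` alive (n + k.+1) : set (traj_space W)).
  by apply: measurableI; [exact: measurable_cylinder|exact: measurable_alive].
set B := P (_ `&` _); set M := P (cylinder n s).
have BM : (B <= M)%E.
  apply: le_measure; rewrite ?inE//; exact: measurable_cylinder.
have Bfin : B \is a fin_num by exact: fin_num_measure mI.
have Mfin : M \is a fin_num by exact: fin_num_measure (measurable_cylinder _ _).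
have c0 : 0 <= 1 - expR (- (r * k%:R)).
  by rewrite subr_ge0 expR_le1 oppr_le0 mulr_ge0.
have BE : B = (\esum_(y in [set: state W])
    P (cylinder n.+1 (extend s n y) `&` alive (n.+1 + k)))%E.
  rewrite /B (measure_next_state n)//.
  by apply: eq_esum => y _; rewrite setIAC cylinder_extend addnS.
have ME : M = (\esum_(y in [set: state W])
    P (cylinder n.+1 (extend s n y)))%E.
  rewrite /M (measure_next_state n (measurable_cylinder _ _)).
  by apply: eq_esum => y _; rewrite cylinder_extend.
have sum_le : ((1 - expR (- (r * k%:R)))%:E * B +
    M * (expR r * F (e :: w))%:E <= M)%E.
  (* The drift inequality is averaged over the actions with the scheduler weights, whose sum is
     1. *)
  apply: (@le_trans _ _ ((1 - expR (- (r * k%:R)))%:E * B + (fine M)%:E *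
      \esum_(y in [set: state W]) (kernel (mkseq s n.+1) (s n) y * F y.1)%:E)%E).
    apply: leeD2l; rewrite fineK//; apply: lee_wpmul2l; first exact: measure_ge0.
    rewrite (esum_kernel hist (fun y => F0 y.1)).
    rewrite -[leLHS]mul1e -(sched_sum1 sigma hist) -sumEFin ge0_sume_distrl; last first.
      by move=> a _; rewrite lee_fin sched_ge0.
    by apply: lee_sum => a _; apply: lee_wpmul2l;
      [rewrite lee_fin sched_ge0|rewrite sw; exact: drift].
  rewrite BE -esumZl//.
  have q0F y : 0 <= kernel (mkseq s n.+1) (s n) y * F y.1 by rewrite mulr_ge0.
  rewrite -esumZl; [|by rewrite fine_ge0// measure_ge0|by []].
  apply: (@le_trans _ _ (\esum_(y in [set: state W])
      ((1 - expR (- (r * k%:R)))%:E *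
         P (cylinder n.+1 (extend s n y) `&` alive (n.+1 + k)) +
       (fine M)%:E * (kernel (mkseq s n.+1) (s n) y * F y.1)%:E))%E).
    rewrite esumD// => y _; first by rewrite mule_ge0 ?lee_fin.
    by rewrite mule_ge0 ?lee_fin ?fine_ge0 ?measure_ge0.
  rewrite [leRHS]ME; apply: le_esum => y _.
  (* The induction hypothesis leaves the mass of the longer cylinder times 1 - F; the drift term
     adds that mass times F, so the mass itself remains. *)
  have := IH n.+1 (extend s n y); rewrite muleC => /(leeD2r _) IHy.
  apply: le_trans (IHy _) _; rewrite cylinder_extendE -/M /extend eqxx fineK//.
  rewrite -(fineK Mfin) -!EFinM -EFinD lee_fin le_eqVlt; apply/orP; left.
  by apply/eqP; ring.
have B0 : (0 <= B)%E by exact: measure_ge0.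
have M0 : (0 <= M)%E by exact: measure_ge0.
move: Bfin Mfin BM B0 M0 sum_le; rewrite {BE ME}.
move: B M => [b||] [m||] // _ _; rewrite !lee_fin => bm b0 m0.
have -> : - (r * k.+1%:R) = - r + - (r * k%:R) by rewrite -natr1; ring.
rewrite expRD.
have : expR (- r) * expR r = 1 by rewrite mulrC expRxMexpNx_1.
have : 0 < expR (- r) <= 1 by rewrite expR_gt0 expR_le1 oppr_le0.
set x := expR (- r); set z := expR r; set v := expR (- _); set f := F _.
move=> /andP[x0 x1] xz sum_le.
(* The goal is x times [sum_le], with x z = 1, plus (1 - x) b <= (1 - x) m. *)
have : x * ((1 - v) * b + m * (z * f)) <= x * m by rewrite ler_wpM2l// ltW.
rewrite mulrDr (_ : x * (m * (z * f)) = m * f * (x * z)); last by ring.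
rewrite xz mulr1.
have : (1 - x) * b <= (1 - x) * m by rewrite ler_wpM2l// subr_ge0.
nra.
Qed.
End Trajectories.

(** * Termination time, choice of the parameters, and the tail bound *)

(** [alive k] covers the times 0 to k inclusive, so it is the event T > k; hence the shift by
    one. *)
Lemma stop_time_geS (R : realType) (W : program) k :
  [set s : trajectory W | (k.+1%:R%:E <= stop_time R s)%E] = alive k.
Proof.
apply/seteqP; split=> s /=; rewrite /stop_time; case: pselect => [ex|nex].
- case: ex_minnP => n _ nmin; rewrite lee_fin ler_nat => kn i ik.
  by apply/negP => /nmin; rewrite leqNgt (leq_ltn_trans ik kn).
- by move=> _ i _; apply/negP => si; apply: nex; exists i.
- move=> sk; case: ex_minnP => n sn _; rewrite lee_fin ler_nat ltnNge.
  by apply/negP => /sk; rewrite sn.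
- by rewrite leey.
Qed.

Lemma stop_time_lty (R : realType) (W : program) :
  [set s : trajectory W | (stop_time R s < +oo)%E] = \bigcup_k ~` alive k.
Proof.
apply/seteqP; split=> s /=; rewrite /stop_time; case: pselect => [ex|nex].
- by move=> _; case: ex => n sn; exists n => // /(_ n (leqnn n)); rewrite sn.
- by rewrite ltxx.
- by move=> _; rewrite ltey.
- by move=> [k _]; case=> i _; apply/negP => si; apply: nex; exists i.
Qed.

Lemma survival_rate (R : realType) (W : program) (Upsilon : sampling R W)
    (Theta_full : forall (f : fname W) (l : label f),
        existT _ f l \in Theta W (mstar W))
    (h : stack_elem W -> \bar R) (h_super : super_measure Upsilon h)
    (sigma : scheduler Upsilon) (c : nt_elem W) (c_fin : (h (val c) < +oo)%E)
    (P : probability (traj_space W) R) (P_induced : induced_measure sigma c P) :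
  exists2 C : R, 0 < C &
    forall k, (0 < k)%N -> (P (alive k) <= (C / Num.sqrt k.+1%:R)%:E)%E.
Proof.
have [h0 [zeta [delta [zeta0 delta0 hc]]]] := h_super.
have h_lout (f : fname W) (nu : pval f) : h (elem (lout f) nu) = 0%E.
  by have [[-> //]] := hc f (lout f) nu.
have h_cond (f : fname W) (l : label f) (nu : pval f) := (hc f l nu).2.
have [m m_delay] := exists_assignment_delay Theta_full.
pose D := (\sum_(x : {f : fname W & label f}) m (tag x) (tagged x)).+1.
have m_lt (f : fname W) (l : label f) : (m f l < D)%N.
  by rewrite ltnS (bigD1 (existT _ f l))//= leq_addr.
have D0 : 0 < D%:R :> R by rewrite ltr0n.
have Ubar1 := Ubar_sum1 P_induced.
(* This choice makes both tau zeta and tau delta at most 1. *)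
pose tau := (zeta + delta)^-1.
have tau0 : 0 < tau by rewrite invr_gt0 addr_gt0.
(* Chosen so that s D = (t delta)^2 / 8, which leaves room for exp(u) <= 1 + 2 u at u = s D. *)
pose kappa := (tau * delta) ^+ 2 / (8 * D%:R).
have kappa0 : 0 < kappa by rewrite divr_gt0 ?exprn_gt0 ?mulr_gt0.
pose x0 := fine (h (val c)); pose y0 := (load m [:: c])%:R : R.
have x00 : 0 <= x0 by rewrite fine_ge0.
(* The denominator comes from s k >= kappa / 2 for k >= 1; the summand 1 makes C visibly
   positive. *)
pose C := (1 + tau * x0 + kappa * y0) / (1 - expR (- (kappa / 2))).
have E0 : 0 < 1 - expR (- (kappa / 2)).
  by rewrite subr_gt0 expR_lt1 oppr_lt0 divr_gt0.
have y00 : 0 <= y0 by [].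
have C0 : 0 < C.
  by rewrite divr_gt0// -addrA ltr_pwDl// addr_ge0// mulr_ge0// ltW.
exists C => // k k0.
set q := Num.sqrt k.+1%:R : R.
have q1 : 1 <= q by rewrite -[leLHS]sqrtr1 ler_sqrt// ler1n.
have q0 : 0 < q by rewrite (lt_le_trans _ q1).
have qq : q ^+ 2 = k.+1%:R by rewrite sqr_sqrtr.
pose t := tau / q; pose s := kappa / k.+1%:R.
have t0 : 0 <= t by apply: divr_ge0; exact: ltW.
have s0 : 0 <= s by apply: divr_ge0 => //; exact: ltW.
have t_tau : t <= tau by rewrite ler_pdivrMr// ler_peMr// ltW.
have tau1 : tau * (zeta + delta) = 1 by rewrite mulVf// gt_eqF// addr_gt0.
have tz : t * zeta <= 1.
  rewrite -tau1 ler_pM//; [exact: ltW|by rewrite lerDl ltW].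
have td : t * delta <= 1.
  rewrite -tau1 ler_pM//; [exact: ltW|by rewrite lerDr ltW].
have sDE : s * D%:R = (t * delta) ^+ 2 / 8.
  rewrite /s /kappa /t -qq; field; rewrite !gt_eqF//.
have sD : expR (s * D%:R) <= 1 + (t * delta) ^+ 2 / 4.
  rewrite sDE; set z := t * delta.
  have z1 : z ^+ 2 <= 1 by rewrite expr_le1// mulr_ge0// ltW.
  have z0 : 0 <= z ^+ 2 by exact: sqr_ge0.
  have := expR_ge1Dx (- (z ^+ 2 / 8)); have := expRxMexpNx_1 (z ^+ 2 / 8).
  have := expR_gt0 (z ^+ 2 / 8).
  (* With u = z^2 / 8 <= 1/8: exp(-u) >= 1 - u and (1 - u)(1 + 2 u) >= 1. *)
  move: (expR (z ^+ 2 / 8)) (expR (- _)) => a b; nra.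
have drift := weight_drift h0 h_lout m_delay t0 s0 tz (ltW delta0) h_cond m_lt sD Ubar1.
have F01 w : 0 <= weight h m t s w <= 1.
  by rewrite weight_ge0 weight_le1.
pose s1 : trajectory W := fun=> ([:: c], [ffun=> 0]).
have := survival_bound P_induced F01 s0 drift k 0%N s1.
have PC : P (cylinder 0 s1) = 1%E.
  by rewrite P_induced /cyl_prob big_ord0 eqxx mul1r.
rewrite PC mul1e add0n.
(* The initial state is almost sure, so intersecting with its cylinder keeps the measure. *)
have -> : P (cylinder 0 s1 `&` alive k) = P (alive k).
  have mC : measurable (cylinder 0 s1 : set (traj_space W)) by exact: measurable_cylinder.
  have mA : measurable (alive k : set (traj_space W)) by exact: measurable_alive.
  rewrite [RHS](measureDI P mA mC) setIC [X in (X + _)%E](_ : _ = 0%E) ?add0e//.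
  apply/eqP; rewrite eq_le measure_ge0 andbT.
  have <- : P (~` cylinder 0 s1) = 0%E by rewrite probability_setC// PC subee.
  apply: le_measure; rewrite ?inE; [exact: measurableD|exact: measurableC|].
  by move=> t' [].
have Pfin : P (alive k) \is a fin_num by exact: fin_num_measure (measurable_alive _).
rewrite -(fineK Pfin) -EFinM !lee_fin => Pk.
have p0 : 0 <= fine (P (alive k)) by rewrite fine_ge0.
have w_ge : 1 - weight h m t s [:: c] <= t * x0 + s * y0.
  rewrite /weight /height big_seq1 lt_eqF// lerBlDr addrC -lerBlDr.
  exact: expR_ge1Dx.
have sk : kappa / 2 <= s * k%:R.
  have -> : s * k%:R = kappa * (k%:R / k.+1%:R) by rewrite /s; ring.
  apply: ler_wpM2l; first exact: ltW.
  rewrite ler_pdivlMr// -[k.+1%:R]natr1; have : 1 <= k%:R :> R by rewrite ler1n.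
  lra.
rewrite ler_pdivlMr// /C ler_pdivlMr//.
have e_le : 1 - expR (- (kappa / 2)) <= 1 - expR (- (s * k%:R)).
  by rewrite lerD2l lerN2 ler_expR lerN2.
have : fine (P (alive k)) * (1 - expR (- (kappa / 2))) <= t * x0 + s * y0.
  by apply: le_trans w_ge; apply: le_trans Pk; rewrite ler_wpM2l.
(* After multiplication by q = sqrt(k+1), t q = tau and s q = kappa / q <= kappa. *)
move=> /(ler_wpM2r (ltW q0)); rewrite mulrAC => /le_trans; apply.
rewrite mulrDl (_ : t * x0 * q = tau * x0); last first.
  by rewrite /t; field; rewrite gt_eqF.
have -> : s * y0 * q = kappa * y0 / q.
  by rewrite /s -qq; field; rewrite gt_eqF.
have : kappa * y0 / q <= kappa * y0.
  by rewrite ler_pdivrMr// ler_peMr// mulr_ge0// ltW.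
lra.
Qed.

Theorem corollary1 (R : realType) (W : program) (Upsilon : sampling R W)
    (Theta_full : forall (f : fname W) (l : label f),
        existT _ f l \in Theta W (mstar W))
    (h : stack_elem W -> \bar R) (h_super : super_measure Upsilon h)
    (sigma : scheduler Upsilon) (c : nt_elem W)
    (c_fin : (0 < h (val c) < +oo)%E)
    (P : probability (traj_space W) R) (P_induced : induced_measure sigma c P) :
  P [set s | (stop_time R s < +oo)%E] = 1%E /\
  (fun k : nat => fine (P [set s | (k%:R%:E <= stop_time R s)%E]) : R^o)
    =O_\oo (fun k : nat => (Num.sqrt (k%:R : R))^-1 : R^o).
Proof.
have /andP[_ c_lty] := c_fin.
have [C C0 rate] := survival_rate Theta_full h_super c_lty P_induced.
have mA k : measurable (alive k : set (traj_space W)) by exact: measurable_alive.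
split.
  have mT : measurable (\bigcup_k ~` alive k : set (traj_space W)).
    by apply: bigcupT_measurable => k; exact: measurableC.
  rewrite stop_time_lty; apply/eqP; rewrite eq_le probability_le1//=.
  have Tfin : P (\bigcup_k ~` alive k) \is a fin_num by exact: fin_num_measure.
  rewrite -(fineK Tfin) lee_fin leNgt; apply/negP; rewrite -subr_gt0.
  (* [e] is the probability of never terminating, which is bounded by that of [alive k] for every
     k. *)
  set e := 1 - _ => e0.
  have e_le k : (0 < k)%N -> e <= C / Num.sqrt k.+1%:R.
    move=> k0; rewrite -lee_fin; apply: le_trans (rate _ k0).
    rewrite EFinB fineK// -probability_setC//; apply: le_measure; rewrite ?inE//.
      exact: measurableC.
    by rewrite setC_bigcup => t /(_ k I); rewrite setCK.
  (* For this k, sqrt(k+1) > C / e, which contradicts [e_le]. *)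
  pose k := (Num.truncn ((C / e) ^+ 2)).+1.
  have := e_le k isT; rewrite leNgt => /negP; apply.
  have Ce : 0 < C / e by rewrite divr_gt0.
  have : (C / e) ^+ 2 < k.+1%:R.
    by apply: lt_trans (_ : _ < k%:R) _; rewrite ?truncnS_gt// ltr_nat.
  rewrite -ltr_sqrt ?ltr0n// sqrtr_sqr gtr0_norm// => ltk.
  rewrite ltr_pdivrMr ?sqrtr_gt0 ?ltr0n// mulrC -ltr_pdivrMr//.
(* The event T >= k+1 is [alive k], and the rate needs k >= 1; hence the threshold 2. *)
apply/eqO_exP; exists C => //; exists 2%N => // -[//|k] /= k0.
rewrite stop_time_geS ger0_norm ?fine_ge0// ger0_norm ?invr_ge0 ?sqrtr_ge0//.
by rewrite -lee_fin fineK ?rate// fin_num_measure.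
Qed.
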